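(* Let $\kappa,\ell\in\mathbb N$ and let $h\in\mathcal F(\kappa,\ell)$ be a permutative block code. Then for every finite word $w\in\mathcal A_\kappa^*$ the prefix permutation map $\Phi^{(h)}_w:\mathcal A_\kappa^{\ell-1}\to\mathcal A_\kappa^{\ell-1}$ is a permutation of $\mathcal A_\kappa^{\ell-1}$. Moreover, for all $w,v\in\mathcal A_\kappa^*$, $$\Phi^{(h)}_{wv}=\Phi^{(h)}_v\circ\Phi^{(h)}_w .$$
   Context: $\mathbb N=\{1,2,\dots\}$, $\mathcal A_\kappa=\{0,\dots,\kappa-1\}$, and $\mathcal A_\kappa^*=\bigcup_{n\ge 0}\mathcal A_\kappa^n$ is the set of finite words (including the empty word); $|w|$ is the length of $w=w_0\ldots w_{|w|-1}$, $w_{[k,n]}=w_k\ldots w_n$, and $wv$ denotes concatenation. A block code of length $\ell$ is a map $h:\mathcal A_\kappa^\ell\to\mathcal A_\kappa$; the set of these is $\mathcal F(\kappa,\ell)$. It is permutative if for every $u\in\mathcal A_\kappa^{\ell-1}$ both maps $a\mapsto h(ua)$ and $a\mapsto h(au)$ are permutations of $\mathcal A_\kappa$. For permutative $h$, $w\in\mathcal A_\kappa^*$ and $u\in\mathcal A_\kappa^{\ell-1}$, there is a unique word $\xi^u(w)\in\mathcal A_\kappa^{|w|+\ell-1}$ whose first $\ell-1$ letters form $u$ and which satisfies $h(\xi^u(w)_{[n,n+\ell-1]})=w_n$ for $0\le n\le |w|-1$. Define $\Phi^{(h)}_w(u)=\xi^u(w)_{[|w|,|w|+\ell-2]}$, i.e.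 the word formed by the last $\ell-1$ letters of $\xi^u(w)$. *)

(* Defs.v *)
From mathcomp Require Import all_boot.
Set Implicit Arguments. Unset Strict Implicit. Unset Printing Implicit Defensive.

(* Finite words over A_kappa are [seq 'I_kappa]; words of fixed length n are
   [n.-tuple 'I_kappa].  The block length ell >= 1 is written [m.+1], so that
   A_kappa^(ell-1) is [m.-tuple 'I_kappa]. *)

Definition block_code (kappa ell : nat) := ell.-tuple 'I_kappa -> 'I_kappa.

Definition permutative (kappa m : nat) (h : block_code kappa m.+1) : Prop :=
  forall u : m.-tuple 'I_kappa,
    bijective (fun a : 'I_kappa => h [tuple of rcons u a]) /\
    bijective (fun a : 'I_kappa => h [tuple of a :: u]).

Lemma subword_size (T : Type) (N : nat) (x : N.-tuple T) (n k : nat) :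
  n + k <= N -> size (take k (drop n x)) == k.
Proof.
move=> nkN; rewrite size_takel // size_drop size_tuple.
by rewrite leq_subRL // (leq_trans _ nkN) // leq_addr.
Qed.

(* The word x_n ... x_(n+k-1). *)
Definition subword (T : Type) (N : nat) (x : N.-tuple T) (n k : nat)
  (nkN : n + k <= N) : k.-tuple T := Tuple (subword_size x nkN).

Lemma window_bound (s m : nat) (n : 'I_s) : n + m.+1 <= s + m.
Proof. by rewrite addnS -addSn leq_add2r. Qed.

Definition is_xi (kappa m : nat) (h : block_code kappa m.+1)
    (u : m.-tuple 'I_kappa) (w : seq 'I_kappa)
    (x : (size w + m).-tuple 'I_kappa) : bool :=
  (subword x (leq_addl (size w) m : 0 + m <= size w + m) == u) &&
  [forall n : 'I_(size w),
     h (subword x (window_bound m n)) == tnth (in_tuple w) n].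

Lemma is_xiP (kappa m : nat) (h : block_code kappa m.+1) (u : m.-tuple 'I_kappa)
    (w : seq 'I_kappa) (x : (size w + m).-tuple 'I_kappa) :
  reflect (take m x = u /\
    forall (a0 : 'I_kappa) n (b : m.+1.-tuple 'I_kappa), n < size w ->
      val b = take m.+1 (drop n x) -> h b = nth a0 w n) (is_xi h u x).
Proof.
apply: (iffP andP) => [[/eqP xu /forallP xw]|[xu xw]]; split.
- by rewrite -xu /= drop0.
- move=> a0 n b nw bE; rewrite -(tnth_nth a0 (in_tuple w) (Ordinal nw)).
  by rewrite -(eqP (xw (Ordinal nw))); congr h; apply: val_inj.
- by apply/eqP/val_inj; rewrite /= drop0.
- apply/forallP => n; rewrite (tnth_nth (tnth (in_tuple w) n)).
  by apply/eqP/xw.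
Qed.

Lemma xi_exists (kappa m : nat) (h : block_code kappa m.+1) (hh : permutative h)
    (u : m.-tuple 'I_kappa) (w : seq 'I_kappa) :
  exists x : (size w + m).-tuple 'I_kappa, is_xi h u x.
Proof.
elim: w u => [|a w IHw] u.
  by exists u; apply/is_xiP; split => //; rewrite take_oversize ?size_tuple.
have [[g _ gK] _] := hh u.
pose t := [tuple of rcons u (g a)]; have [y /is_xiP [yu yw]] := IHw [tuple of behead t].
have tE : thead t :: behead t = t by case/tupleP: t {y yu yw} => c t'; rewrite theadE.
exists [tuple of thead t :: y].
have xt : take m.+1 (thead t :: y) = t by rewrite /= yu tE.
apply/is_xiP; split.
  rewrite -[LHS](take_takel _ (leqnSn m)) xt /=.
  by rewrite -cats1 take_size_cat ?size_tuple.
move=> a0 [|n] b /= nw bE; last exact: yw.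
have -> : b = t by apply: val_inj; rewrite -[RHS]xt.
exact: gK.
Qed.

Lemma xi_unique (kappa m : nat) (h : block_code kappa m.+1) (hh : permutative h)
    (u : m.-tuple 'I_kappa) (w : seq 'I_kappa)
    (x y : (size w + m).-tuple 'I_kappa) :
  is_xi h u x -> is_xi h u y -> x = y.
Proof.
elim: w u x y => [|a w IHw] u x y /is_xiP [xu xw] /is_xiP [yu yw].
  apply: val_inj; rewrite /= -(take_oversize (_ : size x <= m)) ?size_tuple //.
  by rewrite xu -yu take_oversize // size_tuple.
have bd : 0 + m.+1 <= size (a :: w) + m by rewrite addSn ltnS leq_addl.
have subE (z : (size (a :: w) + m).-tuple 'I_kappa) : take m z = u ->
    exists b, val (subword z bd) = rcons u b.
  move=> zu; exists (last a (subword z bd)).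
  rewrite /= drop0 (take_nth a) ?size_tuple ?ltnS ?leq_addl //.
  by rewrite zu last_rcons.
have [b bE] := subE _ xu; have [c cE] := subE _ yu.
have bx : subword x bd = [tuple of rcons u b] by apply: val_inj.
have cy : subword y bd = [tuple of rcons u c] by apply: val_inj.
have ebc : b = c.
  have [/bij_inj inj _] := hh u; apply: inj.
  by rewrite /= -bx -cy (xw a 0) // (yw a 0).
have exy : take m.+1 x = take m.+1 y.
  by have := bE; rewrite ebc -cE /= !drop0.
case/tupleP: x xu xw {bE bx subE} exy => x0 x xu xw.
case/tupleP: y yu yw {cE cy} => y0 y yu yw /= [exy0 exy].
rewrite exy0; congr [tuple of _ :: _].
have sz : size (take m x) == m by rewrite size_takel // size_tuple leq_addl.
apply: (IHw (Tuple sz)); apply/is_xiP; split => //.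
- by move=> a0 n d nw; apply: (xw a0 n.+1).
- by move=> a0 n d nw; apply: (yw a0 n.+1).
Qed.

(* [xchoose] returns the word provided by [xi_exists]; by [xi_unique] it is the
   only one satisfying [is_xi h u]. *)
Definition xi (kappa m : nat) (h : block_code kappa m.+1) (hh : permutative h)
    (u : m.-tuple 'I_kappa) (w : seq 'I_kappa) : (size w + m).-tuple 'I_kappa :=
  xchoose (xi_exists hh u w).

Definition Phi (kappa m : nat) (h : block_code kappa m.+1) (hh : permutative h)
    (w : seq 'I_kappa) (u : m.-tuple 'I_kappa) : m.-tuple 'I_kappa :=
  subword (xi hh u w) (leqnn (size w + m)).

(* Main.v *)
Require Import Defs.
From mathcomp Require Import all_boot.
Set Implicit Arguments. Unset Strict Implicit. Unset Printing Implicit Defensive.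

(** Reading [w] and [v] in succession is the same as reading [w ++ v]: the
    word [xi hh u (w ++ v)] begins with [xi hh u w] and, from position [size w]
    on, is the solution for [v] that starts with the last [m] letters of
    [xi hh u w].  Both claims are instances of the uniqueness of [xi], which
    [Phi_val] packages, and together they are the composition rule [Phi_cat].

    By this rule every [Phi hh w] is a composite of maps [Phi hh [:: a]], so
    bijectivity is needed for a single letter only.  There [xi hh u [:: a]] is
    one block [b :: t] with [h (b :: t) = a] and [t = Phi hh [:: a] u];
    permutativity in the first letter recovers [b] from [t], hence [u], which
    is a prefix of the block ([Phi1_inj]).  An injective self-map of a finite
    set is bijective. *)

Section PrefixPermutation.

Variables (kappa m : nat) (h : block_code kappa m.+1) (hh : permutative h).
Implicit Types (u : m.-tuple 'I_kappa) (w v s : seq 'I_kappa).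

(** A form of [is_xi] for untyped words: cutting and concatenating words changes
    their length only up to propositional equality, which tuples do not absorb. *)
Definition solves u w s : Prop :=
  [/\ size s = size w + m, take m s = u &
    forall (a0 : 'I_kappa) n (b : m.+1.-tuple 'I_kappa), n < size w ->
      val b = take m.+1 (drop n s) -> h b = nth a0 w n].

Lemma xi_solves u w : solves u w (xi hh u w).
Proof.
have /is_xiP [xu xw] := xchooseP (xi_exists hh u w).
by split=> //; rewrite size_tuple.
Qed.

(** By uniqueness of [xi], any solution can be used to compute [Phi]. *)
Lemma Phi_val u w s : solves u w s -> val (Phi hh w u) = drop (size w) s.
Proof.
case=> /eqP sz su sw; pose x := Tuple sz.
have xE : xi hh u w = x.
  apply: (xi_unique hh (xchooseP (xi_exists hh u w))).
  exact/is_xiP.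
by rewrite /= xE take_oversize // size_drop (eqP sz) addKn.
Qed.

Lemma solves_take u w v s :
  solves u (w ++ v) s -> solves u w (take (size w + m) s).
Proof.
case=> sz su sw; split.
- by rewrite size_takel // sz size_cat leq_add2r leq_addr.
- by rewrite take_takel ?leq_addl.
move=> a0 n b nw bE; have := sw a0 n b; rewrite nth_cat nw; apply.
  by rewrite size_cat ltn_addr.
(* The block at [n < size w] ends before position [size w + m]. *)
have nm : m.+1 + n <= size w + m by rewrite addnC (window_bound m (Ordinal nw)).
by rewrite bE !take_drop take_takel.
Qed.

Lemma solves_drop u w v s :
  solves u (w ++ v) s -> solves (Phi hh w u) v (drop (size w) s).
Proof.
move=> xs; have [sz _ sw] := xs; split.
- by rewrite size_drop sz size_cat -addnA addKn.
- by rewrite (Phi_val (solves_take xs)) take_drop addnC.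
move=> a0 n b nv; rewrite drop_drop => bE.
have := sw a0 (n + size w) b; rewrite nth_cat [_ < size w]ltnNge leq_addl addnK; apply=> //.
by rewrite size_cat addnC ltn_add2l.
Qed.

Lemma Phi_cat w v : Phi hh (w ++ v) =1 Phi hh v \o Phi hh w.
Proof.
move=> u; apply: val_inj; have xs := xi_solves u (w ++ v).
rewrite (Phi_val xs) (Phi_val (solves_drop xs)).
by rewrite drop_drop; congr drop; rewrite size_cat addnC.
Qed.

Lemma Phi_nil : Phi hh [::] =1 id.
Proof.
move=> u; apply: val_inj; have [sz su _] := xi_solves u [::].
by rewrite (Phi_val (xi_solves u [::])) drop0 -[RHS]su take_oversize ?sz.
Qed.

(** For a single letter the solution is one block, and its last [m] letters
    are the value of [Phi]. *)
Lemma Phi1_block a u : exists b : 'I_kappa,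
  h [tuple of b :: Phi hh [:: a] u] = a /\ take m (b :: Phi hh [:: a] u) = u.
Proof.
have xs := xi_solves u [:: a]; have [sz su sw] := xs.
have tE := Phi_val xs; move: (val (xi _ _ _)) sz su sw tE => {xs}.
case=> // b t /= [szt] su sw; rewrite drop0 => tE; exists b.
split; last by rewrite tE.
apply: (sw a 0) => //=.
by rewrite tE take_oversize // szt.
Qed.

(** The first letter of the block is the only information that [Phi] discards,
    and left permutativity restores it. *)
Lemma Phi1_inj a : injective (Phi hh [:: a]).
Proof.
move=> u u' euu'; have [b [hb ub]] := Phi1_block a u.
have [b' [hb' ub']] := Phi1_block a u'.
apply: val_inj; rewrite -[LHS]ub -[RHS]ub'.
rewrite -euu' in hb' *; have [_ /bij_inj inj] := hh (Phi hh [:: a] u).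
by rewrite (inj b b') //= hb hb'.
Qed.

Lemma Phi_inj w : injective (Phi hh w).
Proof.
elim: w => [|a w IHw]; first exact: eq_inj (fun _ _ => id) (fsym Phi_nil).
exact: eq_inj (inj_comp IHw (@Phi1_inj a)) (fsym (Phi_cat [:: a] w)).
Qed.

End PrefixPermutation.

Theorem proposition1p2 (kappa m : nat) (kappa_gt0 : 0 < kappa)
    (h : block_code kappa m.+1) (hh : permutative h) :
  (forall w : seq 'I_kappa, bijective (Phi hh w)) /\
  (forall w v : seq 'I_kappa, Phi hh (w ++ v) =1 Phi hh v \o Phi hh w).
Proof.
by split=> [w|w v]; [apply/injF_bij/Phi_inj | apply: Phi_cat].
Qed.
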